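(* Let $\mathcal{M} = \mathbb{R}^n_{++}$, let $f : \mathcal{M} \to \mathbb{R}$ be a smooth function, let $\sigma \in (0,1)$ and let $x \in \mathcal{M}$. For $\tau \ge 0$ put $x(\tau) := x \cdot \exp(-\tau \nabla f(x))$ (componentwise). Then there exists some $\tau_x > 0$ such that $$f(x(\tau)) \le f(x) - \sigma \tau \, \|\nabla_{\mathcal{M}} f(x)\|_x^2 \qquad \text{for all } \tau \in [0, \tau_x].$$
   Context: $\mathbb{R}^n_{++} = \{x \in \mathbb{R}^n : x_i > 0 \text{ for all } i\}$ is the positive orthant, and tangent spaces $T_x\mathcal{M}$ are identified with $\mathbb{R}^n$. Products, quotients, $\exp$ and $\log$ of vectors are taken componentwise. $\nabla f$ is the Euclidean gradient and $\langle\cdot,\cdot\rangle$ the Euclidean inner product. $\mathcal{M}$ carries the Poisson Fisher-Rao metric $g(x) = \mathrm{Diag}(1/x)$, i.e. $\langle u, v\rangle_x = \sum_i u_i v_i / x_i$ and $\|u\|_x^2 = \langle u,u\rangle_x$. The Riemannian gradient is $\nabla_{\mathcal{M}} f(x) = x \nabla f(x)$ (componentwise product), so $\|\nabla_{\mathcal{M}} f(x)\|_x^2 = \sum_i x_i (\partial_i f(x))^2$. The $e$-exponential map is $\mathrm{Exp}^e_x(v) = x \exp(v/x)$, so $x(\tau) = \mathrm{Exp}^e_x(-\tau \nabla_{\mathcal{M}} f(x))$. *)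

(* Defs.v *)
From HB Require Import structures.
From mathcomp Require Import all_boot all_order all_algebra.
From mathcomp Require Import all_classical all_reals all_analysis.
Set Implicit Arguments.
Unset Strict Implicit.
Unset Printing Implicit Defensive.
Import Order.TTheory GRing.Theory Num.Theory.
Import numFieldNormedType.Exports.
Local Open Scope classical_set_scope.
Local Open Scope ring_scope.

Definition orthant (R : realType) (n : nat) : set 'rV[R]_n :=
  [set x | forall i, 0 < x 0 i].

Definition partial (R : realType) (n : nat) (i : 'I_n) (f : 'rV[R]_n -> R) :
    'rV[R]_n -> R :=
  fun x => 'D_(delta_mx 0 i) f x.

(* C^oo on U: the partial derivatives of all orders, in every order of the
   variables, exist and are continuous at each point of U. For U open this
   depends only on the values of f on U, so a function U -> R may be represented
   by any total extension of it. *)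
Definition smooth_on (R : realType) (n : nat) (U : set 'rV[R]_n)
    (f : 'rV[R]_n -> R) : Prop :=
  forall (s : seq 'I_n) (x : 'rV[R]_n), U x ->
    {for x, continuous (foldr (@partial R n) f s)} /\
    forall i, derivable (foldr (@partial R n) f s) x (delta_mx 0 i).

Definition grad (R : realType) (n : nat) (f : 'rV[R]_n -> R) (x : 'rV[R]_n) :
    'rV[R]_n :=
  \row_i partial i f x.

(* The Poisson Fisher-Rao metric: the inner product on T_x M = R^n with matrix
   Diag(1/x). *)
Definition fr_metric (R : realType) (n : nat) (x u v : 'rV[R]_n) : R :=
  \sum_(i < n) u 0 i * v 0 i / x 0 i.

Definition fr_norm (R : realType) (n : nat) (x u : 'rV[R]_n) : R :=
  Num.sqrt (fr_metric x u u).

Definition fr_grad (R : realType) (n : nat) (f : 'rV[R]_n -> R)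
    (x : 'rV[R]_n) : 'rV[R]_n :=
  \row_i (x 0 i * grad f x 0 i).

Lemma fr_gradP (R : realType) (n : nat) (f : 'rV[R]_n -> R) (x v : 'rV[R]_n) :
  orthant x ->
  fr_metric x (fr_grad f x) v = \sum_(i < n) grad f x 0 i * v 0 i.
Proof.
move=> x0; apply: eq_bigr => i _.
by rewrite mxE mulrAC [x 0 i * _]mulrC mulfK// gt_eqF.
Qed.

Definition exp_step (R : realType) (n : nat) (f : 'rV[R]_n -> R)
    (x : 'rV[R]_n) (tau : R) : 'rV[R]_n :=
  \row_i (x 0 i * expR (- tau * grad f x 0 i)).

(* Main.v *)
Require Import Defs.
From HB Require Import structures.
From mathcomp Require Import all_boot all_order all_algebra.
From mathcomp Require Import all_classical all_reals all_analysis.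
From mathcomp Require Import ring lra.
Import Order.TTheory GRing.Theory Num.Theory.
Import numFieldNormedType.Exports.
Local Open Scope classical_set_scope.
Local Open Scope ring_scope.

(** With the Fisher-Rao metric, following the e-exponential map for a small time
    is a first-order descent step. The curve x(tau) = x exp(- tau grad f(x))
    starts at x with velocity - x grad f(x), minus the Riemannian gradient, so
    by the chain rule f(x(tau)) has derivative
      - sum_i x_i (d_i f(x))^2 = - S,   S := |grad_M f(x)|_x^2
    at tau = 0 ([is_derive_along_exp_step]). If S > 0, then - S < - sigma S
    because sigma < 1, and a function whose derivative at 0 is less than c lies
    below the line of slope c on some interval [0, T]
    ([right_le_of_is_derive_lt]). If S = 0, this strict inequality is lost, but
    then every partial derivative vanishes because the x_i are positive, so the
    curve is constant and the inequality is an equality.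

    The chain rule needs f to be Frechet differentiable at x, whereas smoothness
    is expressed here by partial derivatives. The bridge is the classical
    theorem that continuous partial derivatives imply differentiability
    ([is_diff_of_continuous_partials]): move from x to x + h one coordinate at a
    time; by the mean value theorem the k-th move changes f by h_k times a value
    of d_k f near x, which differs from h_k d_k f(x) by at most e |h_k|. *)

Lemma is_derive_line (R : realType) (V : normedModType R) (f : V -> R)
    (y v : V) (t : R) :
  derivable f (y + t *: v) v ->
  is_derive t 1 (fun s : R => f (y + s *: v)) ('D_v f (y + t *: v)).
Proof.
move=> df; pose q (h : R) := h^-1 *: (f (h *: v + (y + t *: v)) - f (y + t *: v)).
have qE : (fun h : R => h^-1 *: (((fun s : R => f (y + s *: v)) \o shift t) (h *: 1)
    - f (y + t *: v))) = q.
  apply/funext => h /=; rewrite /q [h *: 1]mulr1.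
  by rewrite scalerDl addrCA.
by split; rewrite /derivable /derive qE.
Qed.

(** The mean value theorem on the segment from y to y + t v, in the form in which
    errors can be added up. The sign of t is free, so the hypotheses range over
    the whole symmetric segment |s| <= |t|. *)
Lemma line_increment_bound (R : realType) (V : normedModType R) (f : V -> R)
    (y v : V) (t a e : R) :
  (forall s : R, `|s| <= `|t| -> derivable f (y + s *: v) v) ->
  (forall s : R, `|s| <= `|t| -> `|'D_v f (y + s *: v) - a| <= e) ->
  `|f (y + t *: v) - f y - t * a| <= e * `|t|.
Proof.
move=> df fa; pose phi (s : R) := f (y + s *: v).
(* Both signs of t reduce to an ordered segment, [0, t] or [t, 0]. *)
have mv (b c : R) : b <= c -> (forall s, b <= s <= c -> `|s| <= `|t|) ->
    `|phi c - phi b - (c - b) * a| <= e * (c - b).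
  move=> bc st.
  have dphi s : s \in `[b, c]%R -> is_derive s 1 phi ('D_v f (y + s *: v)).
    by rewrite in_itv/= => /st /df; exact: is_derive_line.
  pose D (s : R) : R := 'D_v f (y + s *: v).
  have dD s : s \in `]b, c[%R -> is_derive s 1 phi (D s).
    by move=> sbc; apply: dphi; exact: subset_itv_oo_cc.
  have cphi : {within `[b, c], continuous phi}.
    by apply: derivable_within_continuous => s /dphi[].
  have [s sbc ->] := MVT_segment bc dD cphi.
  rewrite mulrC -mulrBr normrM mulrC (ger0_norm (x := c - b)) ?subr_ge0//.
  by rewrite ler_wpM2r ?subr_ge0// fa// st.
have phi0 : phi 0 = f y by rewrite /phi scale0r addr0.
have [t0|t0] := leP 0 t.
  have := mv 0 t t0; rewrite subr0 phi0 (ger0_norm t0); apply=> s /andP[s0 st].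
  by rewrite ger0_norm.
have := mv t 0 (ltW t0); rewrite sub0r phi0 (ltr0_norm t0).
rewrite -normrN => H; apply: le_trans (H _); last first.
  by move=> s /andP[ts s0]; rewrite ler0_norm// lerN2.
by rewrite le_eqVlt; apply/orP; left; apply/eqP; congr `|_|; rewrite /phi; ring.
Qed.

Lemma coord_le_mx_norm (R : realType) (m n : nat) (A : 'M[R]_(m, n)) i j :
  `|A i j| <= `|A|.
Proof.
rewrite [leRHS]/Num.Def.normr/= mx_normrE.
exact: (le_bigmax _ (fun ij : 'I_m * 'I_n => `|A ij.1 ij.2|) (i, j)).
Qed.

Lemma le_mx_norm_coord (R : realType) (m n : nat) (A B : 'M[R]_(m, n)) :
  (forall i j, `|A i j| <= `|B i j|) -> `|A| <= `|B|.
Proof.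
move=> AB; rewrite [leLHS]/Num.Def.normr/= mx_normrE.
apply: bigmax_le => [|[i j] _]//=.
by apply: le_trans (AB i j) _; exact: coord_le_mx_norm.
Qed.

(** Moving from x to x + h one coordinate at a time: [trunc k] keeps the first k
    coordinates of h, and [line_increment_bound] controls each single move. All
    intermediate points x + z satisfy |z| <= |h| because the norm is the
    supremum norm, for which replacing coordinates of h by smaller ones cannot
    increase the norm. *)
Lemma total_increment_bound (R : realType) (n : nat) (f : 'rV[R]_n -> R)
    (x h : 'rV[R]_n) (e : R) :
  (forall z : 'rV[R]_n, `|z| <= `|h| -> forall i,
    derivable f (x + z) (delta_mx 0 i) /\
    `|partial i f (x + z) - partial i f x| <= e) ->
  `|f (x + h) - f x - \sum_(i < n) grad f x 0 i * h 0 i|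
    <= e * \sum_(i < n) `|h 0 i|.
Proof.
move=> df.
pose trunc k : 'rV[R]_n := \row_i (if (i < k)%N then h 0 i else 0).
have trunc_h : trunc n = h.
  by apply/rowP => i; rewrite mxE ltn_ord.
suff bound k : (k <= n)%N ->
    `|f (x + trunc k) - f x - \sum_(i < n | (i < k)%N) grad f x 0 i * h 0 i|
      <= e * \sum_(i < n | (i < k)%N) `|h 0 i|.
  have := bound n (leqnn n); rewrite trunc_h.
  by rewrite !(eq_bigl (fun i : 'I_n => (i < n)%N) _ (fun i => esym (ltn_ord i))).
elim: k => [_|k IH kn].
  have -> : trunc 0 = 0 by apply/rowP => i; rewrite !mxE.
  by rewrite !big_pred0_eq addr0 !subrr normr0 mulr0.
pose ik := Ordinal kn.
have truncS : trunc k.+1 = trunc k + h 0 ik *: delta_mx 0 ik.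
  apply/rowP => i; rewrite !mxE eqxx/=.
  have [->|ik'] := eqVneq i ik; first by rewrite ltnSn ltnn mulr1 add0r.
  rewrite mulr0 addr0 ltnS leq_eqVlt (_ : (i == k :> nat) = false)//.
  exact/negbTE.
have sumS (F : 'I_n -> R) :
    \sum_(i < n | (i < k.+1)%N) F i = F ik + \sum_(i < n | (i < k)%N) F i.
  rewrite (bigD1 ik)//=; congr (_ + _); apply: eq_bigl => i.
  by rewrite ltnS -val_eqE/= ltn_neqAle andbC.
have step : `|f (x + trunc k + h 0 ik *: delta_mx 0 ik) - f (x + trunc k)
    - h 0 ik * partial ik f x| <= e * `|h 0 ik|.
  have small s : `|s| <= `|h 0 ik| ->
      `|trunc k + s *: delta_mx 0 ik| <= `|h|.
    move=> sh; apply: le_mx_norm_coord => i j; rewrite !mxE ord1 eqxx/=.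
    have [->|jk] := eqVneq j ik; first by rewrite ltnn add0r mulr1.
    by rewrite mulr0 addr0; case: ifP; rewrite ?normr0.
  by apply: line_increment_bound => s /small /df /(_ ik)[]; rewrite addrA.
rewrite !sumS truncS addrA mulrDr.
apply: le_trans (lerD step (IH (ltnW kn))).
apply: le_trans (ler_normD _ _); rewrite le_eqVlt; apply/orP; left; apply/eqP.
by congr `|_|; rewrite /grad mxE; ring.
Qed.

(** Epsilon form of the definition of the differential, free of Landau
    notation. *)
Lemma is_diff_linear (R : numFieldType) (V W : normedModType R) (f : V -> W)
    (df : {linear V -> W}) (x : V) :
  continuous df ->
  (forall e : R, 0 < e ->
    \forall h \near (0 : V), `|f (x + h) - f x - df h| <= e * `|h|) ->
  is_diff x f df.
Proof.
move=> cdf small.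
have odf : f \o shift x = cst (f x) + df +o_ 0 id.
  apply/eqaddoP => e /small; apply: filterS => h.
  by rewrite -[_ - _ - _]addrA -opprD [x + h]addrC.
have dfE : 'd f x = df :> (V -> W) by exact: diff_unique.
by apply: DiffDef => //; apply/diff_locallyP; rewrite dfE.
Qed.

(** Near x every partial derivative is within e / (n + 1) of its value at x, so
    [total_increment_bound] leaves an error of at most
    e / (n + 1) sum_i |h_i| <= e |h|. *)
Lemma is_diff_of_continuous_partials (R : realType) (n : nat)
    (f : 'rV[R]_n -> R) (x : 'rV[R]_n) :
  (forall i, \forall y \near x, derivable f y (delta_mx 0 i)) ->
  (forall i, {for x, continuous (partial i f)}) ->
  is_diff x f (fun h : 'rV[R]_n => \sum_(i < n) grad f x 0 i * h 0 i).
Proof.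
move=> df cf.
pose L (h : 'rV[R]_n) : R := \sum_(i < n) grad f x 0 i * h 0 i.
have linL : linear L.
  move=> a u v; rewrite /L scaler_sumr -big_split/=; apply: eq_bigr => i _.
  by rewrite !mxE mulrDr /GRing.scale/= mulrCA.
pose LM := GRing.isLinear.Build _ _ _ _ _ linL.
pose dL : {linear 'rV[R]_n -> R} := HB.pack L LM.
have cL : continuous dL.
  apply: bounded_linear_continuous; apply/bounded_funP => r.
  exists (\sum_(i < n) `|grad f x 0 i| * r) => h hr.
  apply: le_trans (ler_norm_sum _ _ _) _; apply: ler_sum => i _.
  by rewrite normrM ler_wpM2l// (le_trans (coord_le_mx_norm _ _ _ _ _ _)).
apply: (@is_diff_linear _ _ _ f dL) => // e e0.
  (* n + 1 rather than n, to allow n = 0 *)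
  have en0 : 0 < e / n.+1%:R by rewrite divr_gt0.
  have close (i : 'I_n) : \forall y \near x, derivable f y (delta_mx 0 i) /\
      `|partial i f y - partial i f x| <= e / n.+1%:R.
    near=> y; split; first by near: y; exact: df.
    rewrite distrC; near: y.
    exact: (cvgr_dist_le _ _ (cf i) _ en0).
  have /nbhs_ballP[r /= r0 near_x] :
      \forall y \near x, forall i : 'I_n, derivable f y (delta_mx 0 i) /\
        `|partial i f y - partial i f x| <= e / n.+1%:R.
    exact: (filter_forall _ close).
  near=> h.
  have hr : `|h| < r.
    near: h.
    exact: (@pseudometric_normed_Zmodule.nbhs0_lt R 'rV[R]_n r r0).
  apply: (@le_trans _ _ (e / n.+1%:R * \sum_(i < n) `|h 0 i|)).
    apply: total_increment_bound => z zh i; apply: near_x.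
    rewrite -ball_normE/= opprD addNKr normrN.
    exact: le_lt_trans zh hr.
  have : \sum_(i < n) `|h 0 i| <= n.+1%:R * `|h|.
    apply: (@le_trans _ _ (\sum_(i < n) `|h|)).
      by apply: ler_sum => i _; exact: coord_le_mx_norm.
    by rewrite sumr_const card_ord -[leLHS]mulr_natl ler_wpM2r// ler_nat.
  move=> /(ler_wpM2l (ltW en0)) /le_trans; apply.
  by rewrite mulrA divfK.
Unshelve. all: by end_near. Qed.

Lemma near_orthant (R : realType) (n : nat) (x : 'rV[R]_n) :
  orthant x -> \forall y \near x, orthant y.
Proof.
move=> x0; have coord_gt0 (i : 'I_n) : \forall y \near x, 0 < (y : 'rV[R]_n) 0 i.
  exact: (cvgr_gt (x 0 i) (@coord_continuous R 1 n 0 i x) 0 (x0 i)).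
exact: (filter_forall _ coord_gt0).
Qed.

(** The difference quotients at 0 converge to d < c, so those with a small
    positive step are below c. *)
Lemma right_le_of_is_derive_lt (R : realType) (psi : R -> R) (d c : R) :
  is_derive (0 : R) 1 psi d -> d < c ->
  exists2 T : R, 0 < T & forall t, 0 <= t <= T -> psi t <= psi 0 + c * t.
Proof.
move=> [dpsi <-] dc.
have : \forall h \near (0 : R)^', h^-1 *: ((psi \o shift 0) (h *: 1) - psi 0) < c.
  exact: (cvgr_lt _ dpsi _ dc).
move=> /nbhs_ballP[r /= r0 near0].
(* r / 2 because T itself must be allowed while balls are open *)
exists (r / 2) => [|t /andP[]]; first by rewrite divr_gt0.
rewrite le_eqVlt => /predU1P[<- _|t0 tr]; first by rewrite mulr0 addr0.
have : t^-1 *: ((psi \o shift 0) (t *: 1) - psi 0) < c.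
  apply: near0; last by rewrite gt_eqF.
  rewrite /ball/= sub0r normrN gtr0_norm//; lra.
rewrite /= addr0 [t *: 1]mulr1 [t^-1 *: _]mulrC ltr_pdivrMr// => psit.
lra.
Qed.

Lemma is_derive_exp_step (R : realType) (n : nat) (f : 'rV[R]_n -> R)
    (x : 'rV[R]_n) :
  is_derive (0 : R) 1 (exp_step f x) (- fr_grad f x).
Proof.
have coord i : is_derive (0 : R) 1 (fun tau => exp_step f x tau 0 i)
    (- (x 0 i * grad f x 0 i)).
  have -> : (fun tau => exp_step f x tau 0 i) =
      x 0 i \*: (expR \o ((- grad f x 0 i) \*: (id : R -> R))).
    by apply/funext => tau; rewrite mxE /= [_ *: tau]mulrC mulrN mulNr.
  have lin := is_deriveZ (- grad f x 0 i) (is_derive_id (0 : R) 1).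
  have := is_deriveZ (x 0 i) (is_derive1_comp (is_derive_expR _) lin).
  by rewrite /= scaler0 expR0 mul1r [_ *: 1]mulr1 [_ *: - _]mulrN.
have de : derivable (exp_step f x) 0 1.
  by apply/derivable_mxP => i j; rewrite ord1; case: (coord j).
split => //; rewrite derive_mx//; apply/rowP => j; rewrite mxE.
by rewrite [RHS]mxE [fr_grad _ _ _ _]mxE; case: (coord j).
Qed.

Lemma exp_step0 (R : realType) (n : nat) (f : 'rV[R]_n -> R) (x : 'rV[R]_n) :
  exp_step f x 0 = x.
Proof. by apply/rowP => i; rewrite mxE oppr0 mul0r expR0 mulr1. Qed.

Lemma fr_norm_gradE (R : realType) (n : nat) (f : 'rV[R]_n -> R)
    (x : 'rV[R]_n) : orthant x ->
  fr_norm x (fr_grad f x) ^+ 2 = \sum_(i < n) x 0 i * grad f x 0 i ^+ 2.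
Proof.
move=> x0; have -> : \sum_(i < n) x 0 i * grad f x 0 i ^+ 2 =
    fr_metric x (fr_grad f x) (fr_grad f x).
  by rewrite fr_gradP//; apply: eq_bigr => i _; rewrite [fr_grad _ _ _ _]mxE; ring.
rewrite sqr_sqrtr// fr_gradP//; apply: sumr_ge0 => i _.
by rewrite [fr_grad _ _ _ _]mxE mulrCA -expr2 mulr_ge0 ?sqr_ge0// ltW.
Qed.

(** Chain rule at tau = 0. The Euclidean pairing of grad f(x) with the velocity
    - x grad f(x) of the curve is minus the squared Fisher-Rao norm of the
    Riemannian gradient. *)
Lemma is_derive_along_exp_step (R : realType) (n : nat) (f : 'rV[R]_n -> R)
    (x : 'rV[R]_n) : smooth_on (@orthant R n) f -> orthant x ->
  is_derive (0 : R) 1 (f \o exp_step f x) (- fr_norm x (fr_grad f x) ^+ 2).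
Proof.
move=> sf x0.
have df : is_diff x f (fun h : 'rV[R]_n => \sum_(i < n) grad f x 0 i * h 0 i).
  apply: is_diff_of_continuous_partials => i.
    by apply: filterS (near_orthant _ _ _ x0) => y /(sf [::]) [].
  by have [] := sf [:: i] x x0.
have [de dev] := is_derive_exp_step R n f x.
have dexp : differentiable (exp_step f x) 0 by exact/derivable1_diffP.
have dfe : differentiable f (exp_step f x 0) by rewrite exp_step0; case: df.
have dc : differentiable (f \o exp_step f x) 0 by exact: differentiable_comp.
split; first exact: diff_derivable.
rewrite deriveE// diff_comp//=.
have -> : 'd (exp_step f x) 0 1 = - fr_grad f x by rewrite -deriveE.
rewrite exp_step0 diff_val.
rewrite fr_norm_gradE// -sumrN; apply: eq_bigr => i _.
by rewrite [(- fr_grad f x) 0 i]mxE [fr_grad f x 0 i]mxE; ring.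
Qed.

Theorem theorem3p1 (R : realType) (n : nat) (f : 'rV[R]_n -> R)
    (hf : smooth_on (@orthant R n) f)
    (sigma : R) (hsigma : 0 < sigma < 1)
    (x : 'rV[R]_n) (hx : orthant x) :
  exists2 tau_x : R, 0 < tau_x &
    forall tau : R, 0 <= tau <= tau_x ->
      f (exp_step f x tau) <= f x - sigma * tau * fr_norm x (fr_grad f x) ^+ 2.
Proof.
set S := _ ^+ 2.
have [S0|S0] := eqVneq S 0.
  have g0 i : grad f x 0 i = 0.
    move: S0; rewrite /S fr_norm_gradE// => /psumr_eq0P S0.
    have /eqP := S0 (fun j _ => mulr_ge0 (ltW (hx j)) (sqr_ge0 _)) i isT.
    by rewrite mulf_eq0 gt_eqF//= sqrf_eq0 => /eqP.
  (* the curve is constant, so any positive T would do *)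
  exists 1 => // tau _; rewrite S0 mulr0 subr0.
  rewrite (_ : exp_step f x tau = x)//.
  by apply/rowP => i; rewrite mxE g0 mulr0 expR0 mulr1.
have Spos : 0 < S by rewrite lt0r S0 sqr_ge0.
have [T T0 fT] : exists2 T : R, 0 < T & forall t, 0 <= t <= T ->
    (f \o exp_step f x) t <= (f \o exp_step f x) 0 + - (sigma * S) * t.
  apply: right_le_of_is_derive_lt (is_derive_along_exp_step _ _ _ _ hf hx) _.
  by rewrite ltrN2 gtr_pMl//; case/andP: hsigma.
exists T => // tau /fT /=; rewrite exp_step0 => /le_trans; apply.
by rewrite mulNr mulrAC.
Qed.
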